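(* Let $p\ge 1$, let $\mathcal X=\mathcal X_1\times\cdots\times\mathcal X_p$ carry the product measure $\mu=\mu_1\otimes\cdots\otimes\mu_p$ of $\sigma$-finite measures $\mu_j$ on $\mathcal X_j$, let $\mathcal M\subseteq\{0,1\}^p$ with $0_p\in\mathcal M$, and let $f$ be a probability density on $\mathcal X\times\mathcal M$ with respect to $\nu=\mu\otimes(\text{counting measure on }\mathcal M)$. For $m\in\mathcal M$ let $f(x_{\bar m},m)=\int_{\mathcal X_m} f(x,m)\,\mu(dx_m)$, and assume that $0<f(x_{\bar m},m)<\infty$ for all $m\in\mathcal M$ and $x_{\bar m}\in\mathcal X_{\bar m}$. For each $m\in\mathcal M$ let $\eta_m:\mathcal X_{\bar m}\to\mathbb R$ be defined recursively (along the partial order $\preceq$) by $$\eta_m(x_{\bar m})=\log f(x_{\bar m},m)-\log\int_{\mathcal X_m}\exp\Big\{\sum_{m'\prec m}\eta_{m'}(x_{\bar m'})\,I(m'\in\mathcal M)\Big\}\,\mu(dx_m),$$ where it is assumed that these functions are well defined and real-valued, i.e. that the integrals on the right-hand side are all finite and positive. Let $$g(x,m)=\exp\Big\{\sum_{m'\preceq m}\eta_{m'}(x_{\bar m'})\,I(m'\in\mathcal M)\Big\},\qquad (x,m)\in\mathcal X\times\mathcal M,$$ which is a probability density on $\mathcal X\times\mathcal M$ with respect to $\nu$. If the random vector $(X,M)=(X_1,\dots,X_p,M_1,\dots,M_p)$ taking values in $\mathcal X\times\mathcal M$ has density $g$ with respect to $\nu$, then the nonresponse is itemwise conditionally independent,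 that is, $$X_j\perp\!\!\!\perp M_j\mid X_{-j},M_{-j}\qquad\text{for all } j=1,\dots,p.$$
   Context: Notation. An element $m=(m_1,\dots,m_p)\in\{0,1\}^p$ is called a missingness pattern ($m_j=1$ means item $j$ is missing), and $\bar m=1_p-m$, where $1_p$ and $0_p$ are the vectors of ones and zeros of length $p$. For $x=(x_1,\dots,x_p)\in\mathcal X$, $x_m=(x_j: m_j=1)$ and $x_{\bar m}=(x_j: m_j=0)$, which lie in $\mathcal X_m=\prod_{j:m_j=1}\mathcal X_j$ and $\mathcal X_{\bar m}=\prod_{j:m_j=0}\mathcal X_j$, respectively. The notation $\mu(dx_m)$ means integration over the coordinates $x_j$ with $m_j=1$ against $\prod_{j:m_j=1}\mu_j$, with the coordinates $x_{\bar m}$ held fixed; when $m=0_p$ there is nothing to integrate, so the integral of a function over $\mathcal X_{0_p}$ is the function itself (in particular $\eta_{0_p}(x)=\log f(x,0_p)$, since the sum over $m'\prec 0_p$ is empty). $X_{-j}$ and $M_{-j}$ denote $X$ and $M$ with the $j$th entry removed. Partial order: for $m,m'\in\{0,1\}^p$, $m\preceq m'$ if $m'_j=1$ for every $j$ with $m_j=1$; $m\prec m'$ means $m\preceq m'$ and $m\ne m'$. $I(\cdot)$ is the indicator; terms with $m'\notin\mathcal M$ are taken to be $0$ in the sums. The symbol $A\perp\!\!\!\perp B\mid C$ denotes conditional independence of $A$ and $B$ given $C$. The conclusion means: for each $j$, the conditional probability of $M_j=1$ given $M_{-j}=m_{-j}$ and $X=x$ does not depend on $x_j$, whenever at least one of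 the two patterns that agree with $m_{-j}$ off coordinate $j$ belongs to $\mathcal M$ (with $g(x,m)$ taken as $0$ for $m\notin\mathcal M$). *)

(* Defs.v *)
From HB Require Import structures.
From mathcomp Require Import all_boot all_order all_algebra.
From mathcomp Require Import all_classical all_reals all_analysis.

Set Implicit Arguments.
Unset Strict Implicit.
Unset Printing Implicit Defensive.

Import Order.TTheory GRing.Theory Num.Theory.

Local Open Scope classical_set_scope.
Local Open Scope ring_scope.

Section ProductSpace.
Context (I : finType) (d : I -> measure_display)
  (T : forall i, measurableType (d i)).

Definition cylinders : set (set (forall i, T i)) :=
  \bigcup_i preimage_set_system setT (fun x : forall i, T i => x i) measurable.

Definition prodspace := g_sigma_algebraType cylinders.

HB.instance Definition _ := Measurable.on prodspace.

Lemma measurable_coord i : measurable_fun setT (fun x : prodspace => x i).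
Proof.
move=> _ B mB; apply: sub_sigma_algebra; exists i => //.
by exists B.
Qed.

Lemma measurable_prodspaceP d' (S : measurableType d') (h : S -> prodspace) :
  (forall i, measurable_fun setT (fun s => h s i)) -> measurable_fun setT h.
Proof.
move=> mh; apply: (@measurability _ _ _ prodspace _ _ cylinders) => //.
move=> _ [_ [i _ [B mB <-]] <-]; rewrite setTI.
by have := mh i measurableT B mB; rewrite !setTI.
Qed.

Definition set_coord i (z : prodspace * T i) : prodspace := dfwith z.1 i z.2.

Lemma measurable_set_coord i : measurable_fun setT (@set_coord i).
Proof.
apply: measurable_prodspaceP => j; rewrite /set_coord.
have [->|ji] := eqVneq j i.
  rewrite (_ : (fun s => _) = snd); first exact: measurable_snd.
  by apply/funext => s; rewrite dfwithin.
rewrite (_ : (fun s => _) = (fun x : prodspace => x j) \o fst).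
  apply: measurableT_comp; [exact: measurable_coord|exact: measurable_fst].
by apply/funext => s /=; rewrite dfwithout// eq_sym.
Qed.

Context (R : realType) (mu : forall i, {sigma_finite_measure set (T i) -> \bar R}).

Section AddCoordinate.
Variables (i : I) (m : {measure set prodspace -> \bar R}).

Definition add_coord_measure : set prodspace -> \bar R :=
  pushforward (m \x mu i)%E (@set_coord i).

HB.instance Definition _ := Measure.copy add_coord_measure
  (measure_function_pushforward__canonical__measure_function_Measure
     (m \x mu i)%E (measurable_set_coord (i := i))).

End AddCoordinate.

(* [prod_measure_seq s] is the product of the [mu i] for [i] in [s] and of the
   Dirac measures at an irrelevant base point on the other coordinates. *)
Fixpoint prod_measure_seq (s : seq I) : {measure set prodspace -> \bar R} :=
  if s is i :: s' then add_coord_measure i (prod_measure_seq s')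
  else \d_(point : prodspace).

Definition prod_measure : {measure set prodspace -> \bar R} :=
  prod_measure_seq (enum I).

Definition box (s : seq I) (A : forall i, set (T i)) : set prodspace :=
  [set x | forall i, i \in s -> A i (x i)].

Lemma measurable_box s A : (forall i, measurable (A i)) -> measurable (box s A).
Proof.
move=> mA; elim: s => [|i s ih].
  by rewrite (_ : box _ _ = setT)//; apply/seteqP; split.
rewrite (_ : box _ _ = [set x : prodspace | A i (x i)] `&` box s A).
  apply: measurableI => //; have := @measurable_coord i measurableT _ (mA i).
  by rewrite setTI.
apply/seteqP; split=> x /=.
  move=> h; split; first by apply: h; rewrite mem_head.
  by move=> j js; apply: h; rewrite in_cons js orbT.
by move=> [Ai h] j; rewrite in_cons => /predU1P[->//|/h].
Qed.

Lemma prod_measure_seq_box s A : uniq s -> (forall i, measurable (A i)) ->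
  prod_measure_seq s (box s A) = (\prod_(i <- s) mu i (A i))%E.
Proof.
move=> + mA; elim: s => [_|i s ih /= /andP[his us]].
  rewrite big_nil/= (_ : box _ _ = setT) ?diracT//.
  by apply/seteqP; split.
rewrite big_cons -ih// muleC -product_measure1E//; last exact: measurable_box.
rewrite /add_coord_measure /pushforward/=; congr (_ _); apply/seteqP; split=> -[x t] /=.
  move=> h; split=> /=.
    move=> j js; have := h j; rewrite in_cons js orbT => /(_ isT).
    by rewrite /set_coord dfwithout//; apply: contraNneq his => ->.
  by have := h i; rewrite mem_head => /(_ isT); rewrite /set_coord dfwithin.
move=> [h hi] j; rewrite in_cons => /predU1P[->|js].
  by rewrite /set_coord dfwithin.
by rewrite /set_coord dfwithout; [exact: h|apply: contraNneq his => ->].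
Qed.

(* [prod_measure] is the product measure (the only one, the [mu i] being
   sigma-finite). *)
Lemma prod_measure_box (A : forall i, set (T i)) :
  (forall i, measurable (A i)) ->
  prod_measure [set x | forall i, A i (x i)] = (\prod_i mu i (A i))%E.
Proof.
move=> mA; rewrite -big_enum/= -prod_measure_seq_box ?enum_uniq//.
congr (_ _); apply/seteqP; split=> x /= h i; first by move=> _.
by apply: h; rewrite mem_enum.
Qed.

End ProductSpace.

Section Subvectors.
Context (I : finType) (d : I -> measure_display)
  (T : forall i, measurableType (d i)).

Definition subspace_of (P : pred I) := prodspace (fun k : {j | P j} => T (val k)).

Definition subvector (P : pred I) (x : prodspace T) : subspace_of P :=
  fun k => x (val k).

Definition merge (P : pred I) (y : subspace_of P)
    (z : subspace_of (fun j => ~~ P j)) : prodspace T :=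
  fun j => match boolP (P j) with
           | AltTrue h => y (exist _ j h)
           | AltFalse h => z (exist _ j h)
           end.

End Subvectors.
Arguments subvector {I d T} P x.

(* An element of {0,1}^I, with [true] for 1. *)
Definition pattern (I : finType) := {ffun I -> bool}.

HB.instance Definition _ I := Finite.on (pattern I).
HB.instance Definition _ I := isPointed.Build (pattern I) [ffun=> false].
HB.instance Definition _ I := @isMeasurable.Build default_measure_display
  (pattern I) discrete_measurable discrete_measurable0
  discrete_measurableC discrete_measurableU.

Section Patterns.
Context (I : finType).
Implicit Types m : pattern I.

Definition pattern0 : pattern I := [ffun=> false].

Definition pattern_le m m' := [forall j, m j ==> m' j].
Definition pattern_lt m m' := pattern_le m m' && (m != m').

Definition set_item m (j : I) (b : bool) : pattern I :=
  [ffun k => if k == j then b else m k].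

Definition subpattern (P : pred I) m : pattern {j | P j} :=
  [ffun k => m (val k)].

Context (R : realType) (M : {set pattern I}).

Definition counting_on : set (pattern I) -> \bar R :=
  mrestr (@counting (pattern I) R) (Logic.I : measurable [set` M]).

HB.instance Definition _ := Measure.on counting_on.

Let counting_on_fin : fin_num_fun counting_on.
Proof.
move=> A _; rewrite /counting_on /mrestr /counting asboolT//.
exact: finite_finset.
Qed.

HB.instance Definition _ :=
  Measure_isFinite.Build _ _ _ counting_on counting_on_fin.

End Patterns.
Arguments subpattern {I} P m.

Section Independence.
Context (R : realType) (d : measure_display) (W : measurableType d)
  (P : probability W R).

(* [h] is a version of c |-> P(E | C = c). *)
Definition cond_prob_version dC (TC : measurableType dC) (E : set W)
    (C : W -> TC) (h : TC -> R) :=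
  [/\ measurable_fun setT h,
      P.-integrable setT (fun w => (h (C w))%:E) &
      forall c, measurable c ->
        (\int[P]_(w in C @^-1` c) (h (C w))%:E = P (E `&` C @^-1` c))%E].

(* P(A \in a, B \in b | C) = P(A \in a | C) P(B \in b | C) almost surely; as two
   versions of a conditional probability agree almost surely, it does not matter
   which versions are taken. *)
Definition cond_indep dA dB dC (TA : measurableType dA)
    (TB : measurableType dB) (TC : measurableType dC)
    (A : W -> TA) (B : W -> TB) (C : W -> TC) :=
  [/\ measurable_fun setT A, measurable_fun setT B, measurable_fun setT C &
      forall a b, measurable a -> measurable b ->
      exists ha hb : TC -> R,
        [/\ cond_prob_version (A @^-1` a) C ha,
            cond_prob_version (B @^-1` b) C hb &
            cond_prob_version (A @^-1` a `&` B @^-1` b) C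
              (fun c => ha c * hb c)]].

End Independence.

Section Densities.
Context (R : realType) (d : measure_display) (S : measurableType d)
  (nu : set S -> \bar R) (D : set S).

(* Densities on the space [D], with respect to [nu]. *)
Definition is_prob_density (g : S -> R) :=
  [/\ measurable_fun D g, (forall z, D z -> 0 <= g z) &
      (\int[nu]_(z in D) (g z)%:E = 1)%E].

Definition has_density d' (W : measurableType d') (P : probability W R)
    (V : {RV P >-> S}) (g : S -> R) :=
  forall A, measurable A ->
    (distribution P V A = \int[nu]_(z in A `&` D) (g z)%:E)%E.

End Densities.
Arguments has_density {R d S} nu D {d' W} P V g.

Section MissingData.
Context (R : realType) (p : nat) (d : 'I_p -> measure_display)
  (X : forall j, measurableType (d j))
  (mu : forall j, {sigma_finite_measure set (X j) -> \bar R})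
  (M : {set pattern 'I_p}).
Implicit Types (m : pattern 'I_p) (f g : prodspace X * pattern 'I_p -> R).

Definition obs_space m := subspace_of X (fun j => ~~ m j).

Definition obs m (x : prodspace X) : obs_space m := subvector (fun j => ~~ m j) x.
Arguments obs m x : clear implicits.

Definition full_space : set (prodspace X * pattern 'I_p) := [set z | z.2 \in M].

Definition full_measure : {measure set (prodspace X * pattern 'I_p) -> \bar R} :=
  (prod_measure mu \x counting_on R M)%E.

(* The integral of [h] over the coordinates missing in [m], the observed ones
   being fixed to [z]. *)
Definition integral_mis m (h : prodspace X -> R) (z : obs_space m) : \bar R :=
  (\int[prod_measure (fun k : {j | m j} => mu (val k))]_(y in setT)
     (h (merge y z))%:E)%E.

Definition obs_density f m (z : obs_space m) : \bar R :=
  integral_mis (fun x => f (x, m)) z.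

Definition eta_family := forall m, obs_space m -> R.

Definition eta_norm (eta : eta_family) m (z : obs_space m) : \bar R :=
  integral_mis
    (fun x => expR (\sum_(m' in M | pattern_lt m' m) eta m' (obs m' x))) z.

Definition eta_recursion f (eta : eta_family) :=
  forall m, m \in M -> forall z : obs_space m,
    eta m z = ln (fine (obs_density f z)) - ln (fine (eta_norm eta z)).

(* The density g, extended by 0 to the patterns outside [M]. *)
Definition model_density (eta : eta_family)
    (z : prodspace X * pattern 'I_p) : R :=
  if z.2 \in M then
    expR (\sum_(m' in M | pattern_le m' z.2) eta m' (obs m' z.1))
  else 0.

(* Conditional probability of M_j = 1 given M_{-j} = m_{-j} and X = x when
   (X, M) has density [g]; the value of [m] at [j] is irrelevant. *)
Definition item_cond_prob g (j : 'I_p) (x : prodspace X) m : R :=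
  g (x, set_item m j true) /
  (g (x, set_item m j false) + g (x, set_item m j true)).

Definition item_cond_prob_free g (j : 'I_p) :=
  forall m, (set_item m j false \in M) || (set_item m j true \in M) ->
  forall x x' : prodspace X, (forall k, k != j -> x k = x' k) ->
    item_cond_prob g j x m = item_cond_prob g j x' m.

Definition itemwise_cond_indep d' (W : measurableType d') (P : probability W R)
    (V : {RV P >-> (prodspace X * pattern 'I_p)%type}) :=
  forall j : 'I_p,
    cond_indep P
      (fun w => (V w).1 j)
      (fun w => (V w).2 j)
      (fun w => (subvector (fun k => k != j) (V w).1,
                 subpattern (fun k => k != j) (V w).2)).

End MissingData.
Arguments full_space {p d} X M.
Arguments obs {p d X} m x.
Arguments itemwise_cond_indep {R p d X d' W} P V.

(* Main.v *)
(* The proof rests on two facts.  First, integrating [g] over the coordinates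
   missing in [m] gives [exp (eta_m)] times the normalising integral, which the
   recursion makes equal to [f(x_obs, m)]; so by Tonelli [g] and [f] have the
   same mass on every pattern.  Second, if [m0] and [m1] agree off [j], with
   values 0 and 1 at [j], then
   [g(x, m1) / g(x, m0) = exp (\sum_(m' <= m1, m'_j = 1) eta_m'(x_obs))]
   has no dependence on [x_j], since [j] is missing in all the patterns [m'] of
   the sum.  Hence [M_j] given [(X, M_-j)] has a conditional law [q] that is a
   function of [(X_-j, M_-j)] only, and multiplying a Radon-Nikodym version of
   [P(X_j \in a | X_-j, M_-j)] by [q(b)] gives a version of
   [P(X_j \in a, M_j \in b | X_-j, M_-j)]. *)

Require Import Defs.
From HB Require Import structures.
From mathcomp Require Import all_boot all_order all_algebra.
From mathcomp Require Import all_classical all_reals all_analysis.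
From mathcomp Require Import measurable_realfun.

Set Implicit Arguments.
Unset Strict Implicit.
Unset Printing Implicit Defensive.

Import Order.TTheory GRing.Theory Num.Theory.

Local Open Scope classical_set_scope.
Local Open Scope ring_scope.

(* [path.merge] shadows [Defs.merge]. *)
Local Notation merge := Defs.merge.

(** * Product measures *)

Section ProductMeasure.
Context (I : finType) (d : I -> measure_display)
  (T : forall i, measurableType (d i)) (R : realType)
  (mu : forall i, {sigma_finite_measure set (T i) -> \bar R}).

Lemma measurable_prodset (A : forall i, set (T i)) :
  (forall i, measurable (A i)) ->
  measurable [set x : prodspace T | forall i, A i (x i)].
Proof.
move=> mA; rewrite (_ : mkset _ = box (enum I) A); first exact: measurable_box.
by apply/seteqP; split=> x /= h i; [move=> _|apply: h; rewrite mem_enum].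
Qed.

(** Each factor is exhausted by an increasing sequence of sets of finite measure. Monotonicity
    matters: the coordinates of a point may enter their sequences at different stages, and the box
    taken at the largest of these stages contains the point. *)
Lemma exhausting_prodsets : exists F : forall i, (set (T i))^nat,
  [/\ forall i n, measurable (F i n),
      forall n, (prod_measure mu [set x | forall i, F i n (x i)] < +oo)%E &
      \bigcup_n [set x : prodspace T | forall i, F i n (x i)] = setT].
Proof.
have exF i : exists F, [/\ setT = \bigcup_n F n, nondecreasing_seq F &
    forall n, measurable (F n) /\ (mu i (F n) < +oo)%E].
  exact/sigma_finiteP/sigma_finiteT.
pose F i := sval (cid (exF i)).
have FP i := svalP (cid (exF i)).
have UF i : setT = \bigcup_n F i n by have [] := FP i.
have ndF i : nondecreasing_seq (F i) by have [] := FP i.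
have mF i n : measurable (F i n) by have [_ _ /(_ n)[]] := FP i.
have Foo i n : (mu i (F i n) < +oo)%E by have [_ _ /(_ n)[]] := FP i.
exists F; split=> // [n|].
  rewrite (@prod_measure_box _ _ _ _ mu (fun i => F i n))// -ge0_fin_numE; last first.
    by apply: prode_ge0 => i _; exact: measure_ge0.
  apply: (big_ind (fun x => x \is a fin_num)) => //= [x y|i _].
    exact: fin_numM.
  by rewrite ge0_fin_numE.
apply/seteqP; split=> // x _.
have /choice[n nP] i : exists n, F i n (x i).
  by have /seteqP[/(_ (x i) Logic.I)[n _ Fn] _] := UF i; exists n.
exists (\max_i n i) => // i.
by move: (nP i); apply/subsetPset/ndF/leq_bigmax.
Qed.

Lemma sigma_finite_prod_measure : sigma_finite setT (prod_measure mu).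
Proof.
have [F [mF Foo UF]] := exhausting_prodsets.
exists (fun n => [set x : prodspace T | forall i, F i n (x i)]) => // n.
split; last exact: Foo.
exact: (@measurable_prodset (fun i => F i n)).
Qed.

(* [prod_measure] is only declared as a measure; this copy carries the
   sigma-finite structure that Tonelli's theorem asks for. *)
Definition sf_prod_measure : set (prodspace T) -> \bar R := prod_measure mu.

HB.instance Definition _ := Measure.on sf_prod_measure.

HB.instance Definition _ :=
  Measure_isSigmaFinite.Build _ _ _ sf_prod_measure sigma_finite_prod_measure.

(** Measurable boxes are closed under intersection and generate the sigma-algebra, and by
    [exhausting_prodsets] countably many boxes of finite measure cover the space. Measures that
    agree on boxes therefore agree everywhere. *)
Lemma prod_measure_unique (m : {measure set (prodspace T) -> \bar R}) :
  (forall A : forall i, set (T i), (forall i, measurable (A i)) ->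
     m [set x | forall i, A i (x i)] = (\prod_i mu i (A i))%E) ->
  forall B, measurable B -> prod_measure mu B = m B.
Proof.
move=> mE B mB; have [F [mF Foo UF]] := exhausting_prodsets.
pose G := [set C : set (prodspace T) | exists2 A : forall i, set (T i),
  forall i, measurable (A i) & C = [set x | forall i, A i (x i)]].
apply: (measure_unique G (fun n => [set x | forall i, F i n (x i)])) => //.
- apply/seteqP; split; last first.
    apply: smallest_sub; first exact: sigma_algebra_measurable.
    by move=> _ [A mA ->]; exact: measurable_prodset.
  apply: sub_sigma_algebra2 => _ [i _ [C mC <-]].
  (* A generating cylinder is the box with side [C] at [i] and full sides elsewhere. *)
  exists (dfwith (fun _ => setT) i C).
    by move=> j; have [<-|ij] := eqVneq i j; rewrite ?dfwithin ?dfwithout.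
  rewrite setTI; apply/seteqP; split=> x /=.
    by move=> Cx j; have [<-|ij] := eqVneq i j; rewrite ?dfwithin ?dfwithout.
  by move=> /(_ i); rewrite dfwithin.
- move=> _ _ [A mA ->] [A' mA' ->]; exists (fun i => A i `&` A' i).
    by move=> i; exact: measurableI.
  by apply/seteqP; split=> x /= => [[h h'] i|h]; [split|split=> i; have [] := h i].
- by move=> n; exists (fun i => F i n).
- by move=> _ [A mA ->]; rewrite mE// prod_measure_box.
Qed.

End ProductMeasure.

(** * Gluing complementary subvectors *)

Section Merge.
Context (I : finType) (d : I -> measure_display)
  (T : forall i, measurableType (d i)) (P : pred I).

Lemma mergeT (y : subspace_of T P) (z : subspace_of T (fun j => ~~ P j)) i
  (Pi : P i) : merge y z i = y (exist _ i Pi).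
Proof.
rewrite /merge; destruct (boolP (P i)) as [h|h].
  by rewrite (bool_irrelevance h Pi).
by exfalso; move: (h); rewrite Pi.
Qed.

Lemma mergeF (y : subspace_of T P) (z : subspace_of T (fun j => ~~ P j)) i
  (Pi : ~~ P i) : merge y z i = z (exist _ i Pi).
Proof.
rewrite /merge; destruct (boolP (P i)) as [h|h].
  by exfalso; move: (Pi); rewrite h.
by rewrite (bool_irrelevance h Pi).
Qed.

Lemma subvector_merge (y : subspace_of T P) (z : subspace_of T (fun j => ~~ P j)) :
  subvector (fun j => ~~ P j) (merge y z) = z.
Proof.
by apply: functional_extensionality_dep => -[i Pi]; rewrite /subvector mergeF.
Qed.

Lemma measurable_subvector : measurable_fun setT (@subvector _ _ T P).
Proof.
by apply: measurable_prodspaceP => k; exact: (@measurable_coord _ _ T (val k)).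
Qed.

Lemma measurable_merge : measurable_fun setT
  (fun zy : subspace_of T (fun j => ~~ P j) * subspace_of T P => merge zy.2 zy.1).
Proof.
apply: measurable_prodspaceP => i; have [Pi|Pi] := boolP (P i).
  rewrite (_ : (fun s => _) =
      (fun y : subspace_of T P => y (exist _ i Pi)) \o snd); last first.
    by apply/funext => s; rewrite mergeT.
  apply: measurableT_comp; last exact: measurable_snd.
  exact: (@measurable_coord _ _ _ (exist _ i Pi)).
rewrite (_ : (fun s => _) =
    (fun z : subspace_of T (fun j => ~~ P j) => z (exist _ i Pi)) \o fst); last first.
  by apply/funext => s; rewrite mergeF.
apply: measurableT_comp; last exact: measurable_fst.
exact: (@measurable_coord _ _ _ (exist _ i Pi)).
Qed.

Lemma measurable_mergel (z : subspace_of T (fun j => ~~ P j)) :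
  measurable_fun setT (fun y : subspace_of T P => merge y z).
Proof. exact: (measurableT_comp measurable_merge (pair1_measurable z)). Qed.

End Merge.

(** * The product measure as a product over two blocks of coordinates *)

Section Split.
Context (I : finType) (d : I -> measure_display)
  (T : forall i, measurableType (d i)) (R : realType)
  (mu : forall i, {sigma_finite_measure set (T i) -> \bar R}) (P : pred I).

Let muP (k : {j | P j}) := mu (val k).
Let muN (k : {j | ~~ P j}) := mu (val k).

(** The block outside [P] comes first, so that Tonelli's theorem leaves the integral over the block
    [P] inside, as in [integral_mis]. *)
Definition merge_measure : set (prodspace T) -> \bar R :=
  pushforward (prod_measure muN \x sf_prod_measure muP)%E
    (fun zy => merge zy.2 zy.1).

HB.instance Definition _ := Measure.copy merge_measure
  (measure_function_pushforward__canonical__measure_function_Measure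
     (prod_measure muN \x sf_prod_measure muP)%E (@measurable_merge _ _ T P)).

(** By uniqueness it is enough to look at boxes. The preimage of a box under [merge] is a product of
    two smaller boxes, and the product of the side measures splits according to [P]. *)
Lemma prod_measure_merge A : measurable A -> prod_measure mu A = merge_measure A.
Proof.
apply: prod_measure_unique => {}A mA.
transitivity ((prod_measure muN \x sf_prod_measure muP)%E
  ([set z : subspace_of T (fun j => ~~ P j) | forall k, A (val k) (z k)] `*`
   [set y : subspace_of T P | forall k, A (val k) (y k)])).
  congr ((prod_measure muN \x sf_prod_measure muP)%E _).
  apply/seteqP; split=> -[z y] /=.
    move=> h; split=> -[k Pk] /=; have := h k.
      by rewrite (mergeF _ _ Pk).
    by rewrite (mergeT _ _ Pk).
  move=> [hz hy] i; have [Pi|Pi] := boolP (P i).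
    by rewrite (mergeT _ _ Pi); exact: (hy (exist _ i Pi)).
  by rewrite (mergeF _ _ Pi); exact: (hz (exist _ i Pi)).
have mAN := @measurable_prodset _ _ (fun k : {j | ~~ P j} => T (val k)) _
  (fun k => mA (val k)).
have mAP := @measurable_prodset _ _ (fun k : {j | P j} => T (val k)) _
  (fun k => mA (val k)).
rewrite product_measure1E// /sf_prod_measure.
rewrite (prod_measure_box muN (fun k => mA (val k))).
rewrite (prod_measure_box muP (fun k => mA (val k))).
rewrite [RHS](bigID P)/= muleC; congr (_ * _)%E.
  by rewrite (big_sub P).
by rewrite (big_sub (fun j => ~~ P j)).
Qed.

Lemma ge0_integral_prod_measure_merge (h : prodspace T -> \bar R) :
  measurable_fun setT h -> (forall x, 0 <= h x)%E ->
  (\int[prod_measure mu]_x h x =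
   \int[prod_measure muN]_z \int[prod_measure muP]_y h (merge y z))%E.
Proof.
move=> mh h0.
rewrite (eq_measure_integral merge_measure); last first.
  by move=> A mA _; exact: prod_measure_merge.
rewrite [LHS]ge0_integral_pushforward//; last exact: measurable_merge.
rewrite preimage_setT.
rewrite [LHS](@fubini_tonelli1 _ _ _ _ _ (sf_prod_measure muN) (sf_prod_measure muP))//.
  by apply: measurableT_comp => //; exact: measurable_merge.
by move=> zy /=; exact: h0.
Qed.

Lemma measurable_integral_merge (h : prodspace T -> \bar R) :
  measurable_fun setT h -> (forall x, 0 <= h x)%E ->
  measurable_fun setT
    (fun z => \int[prod_measure muP]_y h (merge y z))%E.
Proof.
move=> mh h0.
apply: (@measurable_fun_fubini_tonelli_F _ _ _ _ _ (sf_prod_measure muP)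
  (fun zy : subspace_of T (fun j => ~~ P j) * subspace_of T P => h (merge zy.2 zy.1))) => //.
by apply: measurableT_comp => //; exact: measurable_merge.
Qed.

End Split.

(** * The model density *)

Section PatternMeasure.
Context (I : finType) (R : realType) (M : {set pattern I}).

Lemma counting_on1 (m : pattern I) : counting_on R M [set m] = (m \in M)%:R%:E.
Proof.
rewrite /counting_on /mrestr; have [mM|mM] := boolP (m \in M).
  rewrite (_ : _ `&` _ = [set m]).
    by rewrite /counting asboolT// fset_set1 finmap.cardfs1.
  by apply/seteqP; split=> [? []|? ->].
rewrite (_ : _ `&` _ = set0) ?measure0//; apply/seteqP; split=> // _ [->] /=.
by rewrite (negbTE mM).
Qed.

Lemma ge0_integral_counting_on (h : pattern I -> \bar R) :
  (forall m, 0 <= h m)%E ->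
  (\int[counting_on R M]_m h m = \sum_(m in M) h m)%E.
Proof.
move=> h0; rewrite (_ : setT = \big[setU/set0]_(m <- enum {: pattern I}) [set m]).
  rewrite ge0_integral_bigsetU//= ?enum_uniq//; last first.
    by move=> m m' _ _ [x [/= <- <-]].
  rewrite big_enum/= [RHS]big_mkcond; apply: eq_bigr => m _.
  rewrite (eq_integral (cst (h m))) => [|x]; last by rewrite inE => ->.
  rewrite integral_cst// [X in (_ * X)%E]counting_on1.
  by case: (m \in M); rewrite ?mule1 ?mule0.
apply/seteqP; split=> // m _; rewrite -bigcup_seq; exists m => //=.
by rewrite mem_enum.
Qed.

(** The pattern space is finite and discrete, so a preimage is a finite union of products of a
    measurable section with a singleton. *)
Lemma measurable_pattern_prod d (S : measurableType d) d' (U : measurableType d')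
    (h : S * pattern I -> U) :
  (forall m, measurable_fun setT (fun x => h (x, m))) -> measurable_fun setT h.
Proof.
move=> mh _ B mB; rewrite setTI.
rewrite (_ : _ @^-1` _ = \bigcup_(m in [set: pattern I])
  (((fun x => h (x, m)) @^-1` B) `*` [set m])).
  apply: fin_bigcup_measurable => [|m _].
    exact: finite_finset.
  by apply: measurableX => //; rewrite -[X in measurable X]setTI; exact: mh.
by apply/seteqP; split=> -[x m] /= => [Bh|[_ _ [/= Bh ->]]]//; exists m.
Qed.

End PatternMeasure.

(** * The reference measure on data and patterns *)

Section FullMeasure.
Context (R : realType) (p : nat) (d : 'I_p -> measure_display)
  (X : forall j, measurableType (d j))
  (mu : forall j, {sigma_finite_measure set (X j) -> \bar R})
  (M : {set pattern 'I_p}).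

Lemma ge0_integral_full_measure (h : prodspace X * pattern 'I_p -> \bar R) :
  (forall m, measurable_fun setT (fun x => h (x, m))) -> (forall z, 0 <= h z)%E ->
  (\int[full_measure mu M]_z h z =
   \int[prod_measure mu]_x \sum_(m in M) h (x, m))%E.
Proof.
move=> mh h0.
rewrite [LHS](@fubini_tonelli1 _ _ _ _ _ (sf_prod_measure mu) (counting_on R M))//.
  by apply: eq_integral => x _; rewrite /fubini_F ge0_integral_counting_on.
exact: measurable_pattern_prod.
Qed.

Lemma ge0_integral_full_measure_sum (h : prodspace X * pattern 'I_p -> \bar R) :
  (forall m, measurable_fun setT (fun x => h (x, m))) -> (forall z, 0 <= h z)%E ->
  (\int[full_measure mu M]_z h z =
   \sum_(m in M) \int[prod_measure mu]_x h (x, m))%E.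
Proof.
move=> mh h0; rewrite ge0_integral_full_measure//.
under eq_integral do rewrite -big_enum/=.
by rewrite ge0_integral_sum// big_enum.
Qed.

(** A copy that carries the sigma-finite structure, under which [g] is later handled as a
    Radon-Nikodym density. *)
Definition sf_full_measure : set (prodspace X * pattern 'I_p) -> \bar R :=
  full_measure mu M.

HB.instance Definition _ := Measure.on sf_full_measure.

Lemma sigma_finite_full_measure : sigma_finite setT sf_full_measure.
Proof.
have [F UF FP] := sigma_finite_prod_measure mu.
exists (fun n => F n `*` setT) => [|n].
  apply/seteqP; split=> // -[x m] _.
  by have /seteqP[/(_ x Logic.I)[n _ Fnx] _] := UF; exists n.
have [mF Foo] := FP n; split; first exact: measurableX.
rewrite [ltLHS](_ : _ = prod_measure mu (F n) * counting_on R M setT)%E; last first.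
  exact: product_measure1E.
rewrite lte_mul_pinfty ?ge0_fin_numE// -ge0_fin_numE//.
exact: fin_num_measure.
Qed.

HB.instance Definition _ :=
  Measure_isSigmaFinite.Build _ _ _ sf_full_measure sigma_finite_full_measure.

Lemma measurable_full_space : measurable (full_space X M).
Proof.
rewrite (_ : full_space X M = setT `*` [set` M]); first exact: measurableX.
by apply/seteqP; split=> -[x m] //= -[].
Qed.

Lemma full_space_section (h : prodspace X * pattern 'I_p -> R) m : m \in M ->
  measurable_fun (full_space X M) h -> measurable_fun setT (fun x => h (x, m)).
Proof.
move=> mM mh; apply: (measurable_comp measurable_full_space _ mh) => //.
by move=> _ [x _ <-].
Qed.

End FullMeasure.

(** * Measurability and total mass of the model density *)

Section ModelDensity.
Context (R : realType) (p : nat) (d : 'I_p -> measure_display)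
  (X : forall j, measurableType (d j))
  (mu : forall j, {sigma_finite_measure set (X j) -> \bar R})
  (M : {set pattern 'I_p}).
Implicit Types m : pattern 'I_p.

Lemma measurable_obs m : measurable_fun setT (@obs p d X m).
Proof. exact: measurable_subvector. Qed.

Lemma obs_merge m y (z : obs_space X m) : obs m (merge y z) = z.
Proof. exact: subvector_merge. Qed.

Lemma measurable_integral_mis m (h : prodspace X -> R) :
  measurable_fun setT h -> (forall x, 0 <= h x) ->
  measurable_fun setT (@integral_mis _ _ _ _ mu m h).
Proof.
move=> mh h0.
apply: (@measurable_integral_merge _ _ X R mu m (EFin \o h)) => //.
exact/measurable_EFinP.
Qed.

Lemma ge0_integral_mis m (h : prodspace X -> R) :
  measurable_fun setT h -> (forall x, 0 <= h x) ->
  (\int[prod_measure mu]_x (h x)%:E =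
   \int[prod_measure (fun k : {j | ~~ m j} => mu (val k))]_z integral_mis mu h z)%E.
Proof.
move=> mh h0.
apply: (@ge0_integral_prod_measure_merge _ _ X R mu m (EFin \o h)) => //.
exact/measurable_EFinP.
Qed.

(** The number of missing items serves as the measure for induction along the strict order of
    patterns. *)
Lemma pattern_lt_card m m' :
  pattern_lt m m' -> (#|[set j | m j]| < #|[set j | m' j]|)%N.
Proof.
case/andP=> /forallP mm' /eqP nmm'; apply: proper_card; rewrite properE.
apply/andP; split; first by apply/fintype.subsetP=> j; rewrite !inE; exact/implyP.
apply/negP => /fintype.subsetP sub; apply: nmm'; apply/ffunP => j.
by apply/idP/idP => [|m'j]; [exact/implyP|have := sub j; rewrite !inE; exact].
Qed.

(** The predicate [Q] is left free to cover both the normalising integral (patterns strictly below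
    [m]) and the density [g] (patterns below or equal to [m]). *)
Lemma measurable_expR_sum_eta (eta : eta_family R X) (Q : pred (pattern 'I_p)) :
  (forall m, m \in M -> Q m -> measurable_fun setT (eta m)) ->
  measurable_fun setT
    (fun x => expR (\sum_(m in M | Q m) eta m (obs m x))).
Proof.
move=> meta; apply: measurableT_comp; first exact: measurable_expR.
(* Replacing the excluded terms by 0 gives a sum over all patterns, in which measurability of [eta]
   is asked only where [Q] holds inside [M]. *)
rewrite (_ : (fun x => _) = fun x => \sum_(m <- enum {: pattern 'I_p})
    (if (m \in M) && Q m then eta m (obs m x) else 0)).
  apply: measurable_sum => m; case: (boolP ((m \in M) && Q m)) => [/andP[mM Qm]//|//].
  by apply: measurableT_comp; [exact: meta|exact: measurable_obs].
by apply/funext => x; rewrite big_mkcond/= [RHS]big_enum.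
Qed.

Context (f : prodspace X * pattern 'I_p -> R)
  (hf : is_prob_density (full_measure mu M) (full_space X M) f)
  (hobs : forall m, m \in M -> forall z : obs_space X m,
     (0 < obs_density mu f z < +oo)%E)
  (eta : eta_family R X)
  (hnorm : forall m, m \in M -> forall z : obs_space X m,
     (0 < eta_norm mu M eta z < +oo)%E)
  (heta : eta_recursion mu M f eta).

Let g := model_density M eta.

(** Measurability is inherited through the recursion: [eta m] is built from an integral of [f] and
    an integral involving only strictly smaller patterns, so strong induction on the number of
    missing items applies. *)
Lemma measurable_eta m : m \in M -> measurable_fun setT (@eta m).
Proof.
have [mf f0 _] := hf.
have [n] := ubnP #|[set j | m j]|; elim: n m => // n ih m mn mM.
rewrite (_ : @eta m = fun z =>
    ln (fine (obs_density mu f z)) - ln (fine (eta_norm mu M eta z))); last first.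
  by apply/funext => z; exact: heta.
apply: measurable_funB.
  apply: measurableT_comp; first exact: measurable_ln.
  apply: measurableT_comp; first exact: fine_measurable.
  apply: measurable_integral_mis; first exact: full_space_section mf.
  by move=> x; exact: f0.
apply: measurableT_comp; first exact: measurable_ln.
apply: measurableT_comp; first exact: fine_measurable.
apply: measurable_integral_mis; last by move=> x; exact: expR_ge0.
apply: measurable_expR_sum_eta => m' m'M m'm.
by apply: ih => //; exact: leq_trans (pattern_lt_card m'm) _.
Qed.

Lemma measurable_model_density_section m :
  measurable_fun setT (fun x => g (x, m)).
Proof.
rewrite /g /model_density/=; case: (boolP (m \in M)) => [mM|_]//.
apply: measurable_expR_sum_eta => m' m'M _; exact: measurable_eta.
Qed.

Lemma measurable_model_density : measurable_fun setT g.
Proof.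
by apply: measurable_pattern_prod => m; exact: measurable_model_density_section.
Qed.

Lemma model_density_ge0 z : 0 <= g z.
Proof. by rewrite /g /model_density; case: ifP => // _; exact: expR_ge0. Qed.

Lemma integral_model_density_section m : m \in M ->
  (\int[prod_measure mu]_x (g (x, m))%:E = \int[prod_measure mu]_x (f (x, m))%:E)%E.
Proof.
have [mf f0 _] := hf.
move=> mM; rewrite (@ge0_integral_mis m); first last.
- by move=> x; exact: model_density_ge0.
- exact: measurable_model_density_section.
rewrite [RHS](@ge0_integral_mis m); first last.
- by move=> x; exact: f0.
- exact: full_space_section mf.
apply: eq_integral => z _.
have [od0 ody] := andP (hobs mM z); have [en0 eny] := andP (hnorm mM z).
(* The summand [m' = m] of the exponent sees only the observed coordinates [z], which are fixed in
   the inner integral, so its exponential factors out. *)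
transitivity ((expR (eta z))%:E * eta_norm mu M eta z)%E.
  rewrite /eta_norm /integral_mis -ge0_integralZl_EFin//; first last.
    apply/measurable_EFinP.
    apply: (@measurableT_comp _ _ _ _ _ _
      (fun x => expR (\sum_(m' in M | pattern_lt m' m) eta (obs m' x)))).
      by apply: measurable_expR_sum_eta => m' m'M _; exact: measurable_eta.
    exact: measurable_mergel.
  apply: eq_integral => y _; rewrite -EFinM -expRD; congr EFin.
  rewrite /g /model_density/= mM; congr expR.
  rewrite (bigD1 m)/=; last by rewrite mM; apply/forallP => j; exact: implybb.
  rewrite obs_merge; congr (_ + _); apply: eq_bigl => m'.
  by rewrite /pattern_lt andbA.
(* By the recursion the factor is the ratio of [obs_density] to [eta_norm]. Both are positive and
   finite, so [fine] loses nothing, [ln] is inverted by [expR] and the normalising integral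
   cancels. *)
rewrite heta// expRD expRN !lnK ?posrE ?fine_gt0 ?od0 ?en0//.
rewrite -[X in (_ * X)%E]fineK; last by rewrite ge0_fin_numE// ltW.
rewrite -EFinM divfK ?gt_eqF ?fine_gt0 ?en0//.
by rewrite fineK// ge0_fin_numE// ltW.
Qed.

Lemma is_prob_density_model_density :
  is_prob_density (full_measure mu M) (full_space X M) g.
Proof.
have [mf f0 f1] := hf; split.
- exact: measurable_funTS measurable_model_density.
- by move=> z _; exact: model_density_ge0.
(* Both total masses become sums over [M] of integrals over the data, to be compared pattern by
   pattern. *)
rewrite -f1 integral_mkcond [RHS]integral_mkcond.
have mD := @measurable_full_space p d X M.
rewrite !ge0_integral_full_measure_sum.
- apply: eq_bigr => m mM; have mem x : (x, m) \in full_space X M by rewrite inE.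
  under eq_integral do rewrite patchE mem.
  under [RHS]eq_integral do rewrite patchE mem.
  exact: integral_model_density_section.
- move=> m; apply: (@measurableT_comp _ _ _ _ _ _ (_ \_ _)) => //.
  by apply/(measurable_restrictT _ mD)/measurable_EFinP.
- by move=> z; apply: erestrict_ge0 => {}z Dz; rewrite lee_fin f0.
- move=> m; apply: (@measurableT_comp _ _ _ _ _ _ (_ \_ _)) => //.
  apply/(measurable_restrictT _ mD)/measurable_EFinP.
  exact: measurable_funTS measurable_model_density.
- by move=> z; apply: erestrict_ge0 => {}z Dz; rewrite lee_fin model_density_ge0.
Qed.

End ModelDensity.

(** * Dependence on a single item *)

Section SetItem.
Context (I : finType) (j : I).
Implicit Types m : pattern I.

Lemma set_itemK m : set_item m j (m j) = m.
Proof. by apply/ffunP => k; rewrite ffunE; case: eqP => [->|]. Qed.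

Lemma set_item_id m b c : set_item (set_item m j b) j c = set_item m j c.
Proof. by apply/ffunP => k; rewrite !ffunE; case: eqP. Qed.

Lemma set_item_at m b : set_item m j b j = b.
Proof. by rewrite ffunE eqxx. Qed.

Lemma set_item_neq m b k : k != j -> set_item m j b k = m k.
Proof. by move=> kj; rewrite ffunE (negbTE kj). Qed.

(** Patterns come in pairs that differ only at [j], each pair being indexed by its member with value
    0 at [j]. *)
Lemma sum_set_item (V : nmodType) (F : pattern I -> V) :
  \sum_m F m =
  \sum_(m : pattern I | ~~ m j) (F (set_item m j false) + F (set_item m j true)).
Proof.
rewrite (bigID (fun m : pattern I => m j))/= addrC big_split/=; congr (_ + _).
  by apply: eq_bigr => m /negbTE mj; rewrite -[in LHS](set_itemK m) mj.
rewrite (reindex_onto (fun m => set_item m j true) (fun m => set_item m j false))/=.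
  apply: eq_bigl => m; rewrite set_item_at/= set_item_id.
  apply/eqP/idP => [<-|/negbTE mj]; first by rewrite set_item_at.
  by rewrite -[RHS](set_itemK m) mj.
by move=> m mj; rewrite set_item_id -[RHS](set_itemK m) mj.
Qed.

(** This splits the exponent of [g] at the pattern with 1 at [j] into the exponent at the pattern
    with 0 at [j] and the terms in which item [j] is missing. *)
Lemma pattern_le_set_item m m' :
  pattern_le m' (set_item m j false) = pattern_le m' (set_item m j true) && ~~ m' j.
Proof.
apply/forallP/andP => [h|[/forallP h m'j] k].
  split; last by have := h j; rewrite set_item_at implybF.
  apply/forallP => k; have := h k; rewrite !ffunE; case: eqP => // _.
  by rewrite implybT.
have := h k; rewrite !ffunE; case: eqP => // -> _.
by rewrite implybF.
Qed.

End SetItem.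

Section ItemCondProb.
Context (R : realType) (p : nat) (d : 'I_p -> measure_display)
  (X : forall j, measurableType (d j)) (M : {set pattern 'I_p}).
Implicit Types m : pattern 'I_p.

Lemma obs_eq_off m j (x x' : prodspace X) : m j ->
  (forall k, k != j -> x k = x' k) -> obs m x = obs m x'.
Proof.
move=> mj xx'; apply: functional_extensionality_dep => -[k mk].
by rewrite /obs /subvector/= xx'//; apply: contraNneq mk => ->.
Qed.

Lemma item_cond_prob_model_density (eta : eta_family R X) j m (x x' : prodspace X) :
  (forall k, k != j -> x k = x' k) ->
  item_cond_prob (model_density M eta) j x m =
  item_cond_prob (model_density M eta) j x' m.
Proof.
move=> xx'; rewrite /item_cond_prob /model_density/=.
(* If the pattern with 1 at [j] is outside [M], both numerators are 0. *)
case: ifP => m1M; last by rewrite !mul0r.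
(* If only the pattern with 1 at [j] lies in [M], both ratios are 1. *)
case: ifP => m0M; last by rewrite !add0r !divff ?gt_eqF ?expR_gt0.
(* [S] may depend on the [j]th coordinate but is common to numerator and denominator; [A] collects
   the terms in which item [j] is missing and ignores that coordinate. The ratio is
   [expR A / (1 + expR A)]. *)
pose S y := \sum_(m' in M | pattern_le m' (set_item m j false)) eta m' (obs m' y).
pose A y := \sum_(m' in M | pattern_le m' (set_item m j true) && m' j)
  eta m' (obs m' y).
have SE y : \sum_(m' in M | pattern_le m' (set_item m j true)) eta m' (obs m' y)
    = S y + A y.
  rewrite (bigID (fun m' => m' j))/= addrC; congr (_ + _); apply: eq_bigl => m'.
    by rewrite pattern_le_set_item andbA.
  by rewrite andbA.
rewrite !SE -!/(S _) !expRD.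
have -> : A x' = A x.
  by apply: eq_bigr => m' /andP[_ /andP[_ m'j]]; rewrite (obs_eq_off m'j xx').
have e0 t : expR (S t) != 0 by rewrite gt_eqF ?expR_gt0.
have e1 t : expR (S t) * (1 + expR (A x)) = expR (S t) + expR (S t) * expR (A x).
  by rewrite mulrDr mulr1.
by rewrite -!e1 -!mulf_div !divff.
Qed.

End ItemCondProb.

Section Density.
Context (R : realType) d (T : measurableType d).

(** The formula for sets makes [nu] absolutely continuous, and its Radon-Nikodym derivative has the
    same integrals over sets as [g]. The two agree almost everywhere, so the change of variables for
    the derivative carries over to [g]. *)
Lemma ge0_integral_density (nu : {finite_measure set T -> \bar R})
    (mu : {sigma_finite_measure set T -> \bar R}) (g : T -> R) :
  measurable_fun setT g -> (forall x, 0 <= g x) ->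
  (forall A, measurable A -> nu A = \int[mu]_(x in A) (g x)%:E)%E ->
  forall h : T -> \bar R, measurable_fun setT h -> (forall x, 0 <= h x)%E ->
  (\int[nu]_x h x = \int[mu]_x (h x * (g x)%:E))%E.
Proof.
move=> mg g0 nuE h mh h0.
have numu : nu `<< mu.
  apply/null_content_dominatesP => A mA A0; rewrite nuE//.
  by apply: null_set_integral => //; exact/measurable_funTS/measurable_EFinP.
rewrite -(Radon_Nikodym_SigmaFinite.change_of_variables numu)//.
have irn := Radon_Nikodym_SigmaFinite.f_integrable numu.
apply: ge0_ae_eq_integral => //.
- apply: emeasurable_funM => //; exact: measurable_int irn.
- by apply: emeasurable_funM => //; exact/measurable_EFinP.
- by move=> x _; rewrite mule_ge0// Radon_Nikodym_SigmaFinite.f_ge0.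
- by move=> x _; rewrite mule_ge0// lee_fin.
apply: ae_eqe_mul2l; apply: integral_ae_eq => //; first exact/measurable_EFinP.
by move=> A _ mA; rewrite -Radon_Nikodym_SigmaFinite.f_integral// nuE.
Qed.

End Density.

(** * Existence of conditional probabilities *)

Section FinitePushforward.
Context d d' (T : measurableType d) (U : measurableType d') (R : realType)
  (m : {finite_measure set T -> \bar R}) (f : T -> U)
  (mf : measurable_fun setT f).

(** The measurability proof is an explicit argument so that the finite measure structure, which
    depends on it, can be inferred from the term. *)
Definition finite_pushforward of measurable_fun setT f : set U -> \bar R :=
  pushforward m f.

HB.instance Definition _ := Measure.copy (finite_pushforward mf)
  (measure_function_pushforward__canonical__measure_function_Measure m mf).

Lemma finite_pushforward_fin : fin_num_fun (finite_pushforward mf).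
Proof.
move=> A mA; apply: (@fin_num_measure _ _ _ m).
by rewrite -[X in measurable X]setTI; exact: mf.
Qed.

HB.instance Definition _ := Measure_isFinite.Build _ _ _
  (finite_pushforward mf) finite_pushforward_fin.

Lemma ge0_integral_finite_pushforward (A : set U) (h : U -> \bar R) :
  measurable A -> measurable_fun setT h -> (forall u, 0 <= h u)%E ->
  (\int[finite_pushforward mf]_(u in A) h u = \int[m]_(t in f @^-1` A) h (f t))%E.
Proof.
move=> mA mh h0; rewrite [LHS]ge0_integral_pushforward//.
exact: measurable_funTS.
Qed.

End FinitePushforward.

Section CondProb.
Context (R : realType) (d : measure_display) (W : measurableType d)
  (P : probability W R).

Section Restriction.
Context (E : set W) (mE : measurable E).

Definition prob_restr : set W -> \bar R := mrestr P mE.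

HB.instance Definition _ := Measure.on prob_restr.

Lemma prob_restr_fin : fin_num_fun prob_restr.
Proof. by move=> A mA; exact: (@fin_num_measure _ _ _ P _ (measurableI _ _ mA mE)). Qed.

HB.instance Definition _ :=
  Measure_isFinite.Build _ _ _ prob_restr prob_restr_fin.

(** The restricted measure has the indicator of [E] as density with respect to [P]. *)
Lemma ge0_integral_prob_restr (A : set W) (h : W -> \bar R) :
  measurable A -> measurable_fun setT h -> (forall w, 0 <= h w)%E ->
  (\int[prob_restr]_(w in A) h w = \int[P]_(w in E `&` A) h w)%E.
Proof.
move=> mA mh h0; rewrite integral_mkcond.
rewrite (@ge0_integral_density _ _ _ prob_restr P (\1_E : W -> R))//; first last.
- by move=> w; apply: erestrict_ge0.
- apply/(measurable_restrictT _ mA); exact: measurable_funTS.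
- by move=> B mB; rewrite integral_indic// setIC.
rewrite [RHS]integral_mkcond; apply: eq_integral => w _.
rewrite !patchE in_setI indicE; case: (w \in E) => /=; first by rewrite mule1.
by rewrite mule0.
Qed.

End Restriction.

Section Existence.
Context (dC : measure_display) (TC : measurableType dC)
  (E : set W) (mE : measurable E) (C : W -> TC) (mC : measurable_fun setT C).

(** The version is the Radon-Nikodym derivative of the law of [C] on the event [E] with respect to
    the law of [C]. The last clause extends the defining property to nonnegative weights that are
    functions of [C], as needed to multiply two conditional probabilities. *)
Lemma exists_cond_prob_version : exists h : TC -> R,
  [/\ forall c, 0 <= h c, cond_prob_version P E C h &
      forall (q : TC -> R) (c : set TC), measurable c ->
        measurable_fun setT q -> (forall t, 0 <= q t) ->
        (\int[P]_(w in C @^-1` c) (h (C w) * q (C w))%:E =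
         \int[P]_(w in E `&` C @^-1` c) (q (C w))%:E)%E].
Proof.
pose nu := finite_pushforward (prob_restr mE) mC.
pose PC := finite_pushforward P mC.
have numu : nu `<< PC.
  apply/null_content_dominatesP => A mA PCA0; apply/eqP.
  rewrite eq_le measure_ge0 andbT -PCA0.
  have mCA : measurable (C @^-1` A) by rewrite -[X in measurable X]setTI; exact: mC.
  by apply: le_measure; rewrite ?inE//; exact: measurableI.
pose r := Radon_Nikodym_SigmaFinite.f nu PC.
have r0 c : (0 <= r c)%E by exact: Radon_Nikodym_SigmaFinite.f_ge0.
have rfin c : r c \is a fin_num by exact: Radon_Nikodym_SigmaFinite.f_fin_num.
have irn : PC.-integrable setT r by exact: Radon_Nikodym_SigmaFinite.f_integrable.
have mr : measurable_fun setT r by exact: measurable_int irn.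
have mh : measurable_fun setT (fine \o r).
  by apply: measurableT_comp => //; exact: fine_measurable.
have h0 c : 0 <= fine (r c) by exact: fine_ge0.
have hint (q : TC -> R) (c : set TC) : measurable c ->
    measurable_fun setT q -> (forall t, 0 <= q t) ->
    (\int[P]_(w in C @^-1` c) (fine (r (C w)) * q (C w))%:E =
     \int[P]_(w in E `&` C @^-1` c) (q (C w))%:E)%E.
  move=> mc mq q0.
  have mCc : measurable (C @^-1` c) by rewrite -[X in measurable X]setTI; exact: mC.
  rewrite -(ge0_integral_prob_restr mE mCc (h := fun w => (q (C w))%:E)); first last.
  - by move=> w; rewrite lee_fin.
  - by apply/measurable_EFinP; exact: measurableT_comp.
  rewrite -(ge0_integral_finite_pushforward (prob_restr mE) mC (h := EFin \o q))//; first last.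
    exact/measurable_EFinP.
  rewrite -(Radon_Nikodym_SigmaFinite.change_of_variables numu)//; first last.
    exact/measurable_funTS/measurable_EFinP.
  rewrite [RHS]ge0_integral_finite_pushforward//; first last.
  - by move=> t; rewrite mule_ge0// lee_fin.
  - by apply: emeasurable_funM => //; exact/measurable_EFinP.
  by apply: eq_integral => w _; rewrite EFinM fineK// muleC.
exists (fine \o r); split => //.
have hE (c : set TC) : measurable c ->
    (\int[P]_(w in C @^-1` c) (fine (r (C w)))%:E = P (E `&` C @^-1` c))%E.
  (* The constant weight 1 gives back the defining property of a version. *)
  move=> mc; have := hint (cst 1) c mc.
  under eq_integral do rewrite mulr1.
  move=> ->//.
  rewrite [LHS](integral_cst P _ 1%E) ?mul1e//; apply: measurableI => //.
  by rewrite -[X in measurable X]setTI; exact: mC.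
split=> //; apply/integrableP; split.
  by apply/measurable_EFinP; apply: (measurableT_comp mh).
under eq_integral do rewrite gee0_abs ?lee_fin//=.
have := hE setT measurableT; rewrite preimage_setT => ->.
rewrite -ge0_fin_numE//; apply: fin_num_measure.
by rewrite setIT.
Qed.

End Existence.

End CondProb.

(** * Conditional independence *)

Section CondIndep.
Context (R : realType) (p : nat) (d : 'I_p -> measure_display)
  (X : forall j, measurableType (d j))
  (mu : forall j, {sigma_finite_measure set (X j) -> \bar R})
  (M : {set pattern 'I_p}) (g : prodspace X * pattern 'I_p -> R)
  (mg : measurable_fun setT g) (g0 : forall z, 0 <= g z)
  (gM : forall x m, m \notin M -> g (x, m) = 0) (j : 'I_p)
  (free : forall m (x x' : prodspace X), (forall k, k != j -> x k = x' k) ->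
     item_cond_prob g j x m = item_cond_prob g j x' m).

(** The conditional law of the [j]th indicator given all the data and the other indicators,
    evaluated at [b]. Where the denominator of [item_cond_prob] is 0, it is the point mass at
    [false]. *)
Definition item_prob (b : set bool) (z : prodspace X * pattern 'I_p) : R :=
  \1_b true * item_cond_prob g j z.1 z.2 +
  \1_b false * (1 - item_cond_prob g j z.1 z.2).

Lemma item_cond_prob01 x m : 0 <= item_cond_prob g j x m <= 1.
Proof.
rewrite /item_cond_prob; apply/andP; split; first by rewrite divr_ge0// addr_ge0.
set s := _ + _; have [->|s0] := eqVneq s 0; first by rewrite invr0 mulr0.
by rewrite ler_pdivrMr ?mul1r ?lerDr// lt_def s0 addr_ge0.
Qed.

Lemma indic01 T (A : set T) t : 0 <= (\1_A t : R) <= 1.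
Proof. by rewrite indicE; case: (t \in A); rewrite /= ?lexx ?ler01. Qed.

Lemma item_prob01 b z : 0 <= item_prob b z <= 1.
Proof.
have /andP[i0 i1] := item_cond_prob01 z.1 z.2.
have /andP[t0 t1] := indic01 b true; have /andP[f0 f1] := indic01 b false.
apply/andP; split.
  by rewrite addr_ge0// mulr_ge0// subr_ge0.
rewrite -[leRHS](subrK (item_cond_prob g j z.1 z.2)) addrC lerD//;
  by rewrite ler_piMl// subr_ge0.
Qed.

Lemma item_prob_set_item b x m c :
  item_prob b (x, set_item m j c) = item_prob b (x, m).
Proof. by rewrite /item_prob /item_cond_prob/= !set_item_id. Qed.

Lemma item_prob_off b x x' m : (forall k, k != j -> x k = x' k) ->
  item_prob b (x, m) = item_prob b (x', m).
Proof. by move=> xx'; rewrite /item_prob/= (free _ xx'). Qed.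

(** Clearing the denominator is legitimate even when it is 0: by nonnegativity both values of [g]
    then vanish. *)
Lemma item_probM b x m :
  item_prob b (x, m) * (g (x, set_item m j false) + g (x, set_item m j true)) =
  \1_b false * g (x, set_item m j false) + \1_b true * g (x, set_item m j true).
Proof.
rewrite /item_prob /item_cond_prob/=.
set a := g (x, set_item m j false); set c := g (x, set_item m j true).
have [s0|s0] := eqVneq (a + c) 0.
  move/eqP: s0; rewrite paddr_eq0 ?g0// => /andP[/eqP-> /eqP->].
  by rewrite addr0 !mulr0 addr0.
rewrite mulrDl -!mulrA mulrBl mul1r -!mulrA mulVf// mulr1.
by rewrite addrK addrC.
Qed.

Lemma measurable_section m : measurable_fun setT (fun x => g (x, m)).
Proof. exact: (measurableT_comp mg (pair2_measurable m)). Qed.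

Lemma measurable_item_prob b : measurable_fun setT (item_prob b).
Proof.
apply: measurable_pattern_prod => m.
have mi : measurable_fun setT (fun x => item_cond_prob g j x m).
  (* [s^-1 = expR (- ln s)] for [s > 0]; when the denominator [s] is 0, so is
     the factor [g (x, set_item m j true)]. *)
  rewrite (_ : (fun x => _) = fun x => g (x, set_item m j true) *
      expR (- ln (g (x, set_item m j false) + g (x, set_item m j true)))).
    apply: measurable_funM; first exact: measurable_section.
    apply: measurableT_comp; first exact: measurable_expR.
    apply: measurable_funN; apply: measurableT_comp; first exact: measurable_ln.
    by apply: measurable_funD; exact: measurable_section.
  apply/funext => x; rewrite /item_cond_prob.
  set a := g (x, set_item m j false); set c := g (x, set_item m j true).
  have [s0|s0] := eqVneq (a + c) 0.
    by move/eqP: s0; rewrite paddr_eq0 ?g0// => /andP[_ /eqP->]; rewrite !mul0r.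
  by rewrite expRN lnK// posrE lt_def s0 addr_ge0 ?g0.
apply: measurable_funD; apply: measurable_funM => //.
exact: measurable_funB.
Qed.

Context d' (W : measurableType d') (P : probability W R)
  (V : {RV P >-> (prodspace X * pattern 'I_p)%type})
  (hV : forall A, measurable A ->
     distribution P V A = (\int[full_measure mu M]_(z in A) (g z)%:E)%E).

Let mV : measurable_fun setT V.
Proof. exact: measurable_funPT. Qed.

Definition item_in (b : set bool) : set (prodspace X * pattern 'I_p) :=
  [set z : prodspace X * pattern 'I_p | b (z.2 j)].

Lemma measurable_item_in b : measurable (item_in b).
Proof.
rewrite (_ : item_in _ = setT `*` [set m : pattern 'I_p | b (m j)]).
  exact: measurableX.
by apply/seteqP; split=> -[x m] //= -[].
Qed.

(** An event [E] stable under changes of item [j] is one expressed through the data and the other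
    indicators, so this says that [item_prob b] is a conditional probability given those. On each
    pair of patterns differing at [j], both the indicator of [E] and [item_prob b] are constant, and
    [item_probM] gives the balance. *)
Lemma integral_item_prob (b : set bool) (E : set (prodspace X * pattern 'I_p)) :
  measurable E -> (forall x m c, E (x, m) -> E (x, set_item m j c)) ->
  (\int[P]_(w in V @^-1` E) (item_prob b (V w))%:E =
   P (V @^-1` (E `&` item_in b)))%E.
Proof.
move=> mE Eflip.
have mEb : measurable (E `&` item_in b).
  by apply: measurableI => //; exact: measurable_item_in.
have q0 z : 0 <= item_prob b z by case/andP: (item_prob01 b z).
have mq := measurable_item_prob b.
have mEq : measurable_fun setT ((EFin \o item_prob b) \_ E).
  by apply/(measurable_restrictT _ mE)/measurable_funTS/measurable_EFinP.
have mEg : measurable_fun setT ((EFin \o g) \_ (E `&` item_in b)).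
  by apply/(measurable_restrictT _ mEb)/measurable_funTS/measurable_EFinP.
transitivity (\int[distribution P V]_(z in E) (item_prob b z)%:E)%E.
  rewrite [RHS]ge0_integral_pushforward//; last by move=> z _; rewrite lee_fin.
  exact/measurable_funTS/measurable_EFinP.
rewrite integral_mkcond.
rewrite (@ge0_integral_density _ _ _ (distribution P V)
  (sf_full_measure mu M) g)//; last first.
  by move=> z; apply: erestrict_ge0 => {}z _; rewrite lee_fin.
rewrite [RHS](hV mEb) [RHS]integral_mkcond.
rewrite [LHS]ge0_integral_full_measure; first last.
- by move=> z; rewrite mule_ge0 ?lee_fin//; apply: erestrict_ge0 => {}z _;
  rewrite lee_fin.
- move=> m; apply: emeasurable_funM.
    exact: (measurableT_comp mEq (pair2_measurable m)).
  by apply/measurable_EFinP; exact: measurable_section.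
rewrite [RHS]ge0_integral_full_measure; first last.
- by move=> z; apply: erestrict_ge0 => {}z _; rewrite lee_fin.
- by move=> m; exact: (measurableT_comp mEg (pair2_measurable m)).
apply: eq_integral => x _.
(* As [g] is 0 outside [M], the sum may run over all patterns; this is what allows pairing, since
   changing item [j] can leave [M]. *)
transitivity (\sum_m \1_E (x, m) * item_prob b (x, m) * g (x, m))%:E.
  rewrite -sumEFin big_mkcond; apply: eq_bigr => m _.
  rewrite patchE indicE; case: ifPn => [mM|mM]; last by rewrite gM// mulr0.
  by case: ((x, m) \in E); rewrite ?mul1r ?mul0r //; exact: mul0e.
transitivity (\sum_m \1_E (x, m) * \1_b (m j) * g (x, m))%:E; last first.
  rewrite -sumEFin [RHS]big_mkcond; apply: eq_bigr => m _.
  rewrite patchE !indicE in_setI; case: ifPn => [mM|mM]; last by rewrite gM// mulr0.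
  have -> : ((x, m) \in item_in b) = (m j \in b).
    by apply/idP/idP; rewrite !inE.
  by case: ((x, m) \in E); case: (m j \in b); rewrite /= ?mul1r ?mul0r.
congr EFin; rewrite (sum_set_item j) [RHS](sum_set_item j).
apply: eq_bigr => m _; rewrite !item_prob_set_item !set_item_at.
have Em c : \1_E (x, set_item m j c) = \1_E (x, m) :> R.
  rewrite !indicE; congr ((nat_of_bool _)%:R); apply/idP/idP; rewrite !inE.
    (* The converse resets item [j] to its original value [m j]. *)
    by move=> /(@Eflip _ _ (m j)); rewrite set_item_id set_itemK.
  exact: Eflip.
by rewrite !Em -!mulrA -!mulrDr item_probM.
Qed.

Let A w := (V w).1 j.
Let B w := (V w).2 j.
Let C w := (subvector (fun k => k != j) (V w).1, subpattern (fun k => k != j) (V w).2).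

Let restr (z : prodspace X * pattern 'I_p) :=
  (subvector (fun k => k != j) z.1, subpattern (fun k => k != j) z.2).

(* The junk entries at [j] do not matter: [item_prob b] ignores them. *)
Definition extend_off
    (c : subspace_of X (fun k => k != j) * pattern {k | k != j}) :
    prodspace X * pattern 'I_p :=
  (merge c.1 point, [ffun k => if insub k is Some k' then c.2 k' else false]).

Lemma measurable_extend_off : measurable_fun setT extend_off.
Proof.
apply: measurable_pattern_prod => n; apply: measurable_fun_pair => /=;
  last exact: measurable_cst.
exact: (measurableT_comp (@measurable_merge _ _ X (fun k => k != j))
         (pair1_measurable point)).
Qed.

(** The map [restr] forgets the datum and the indicator of item [j]. The first is irrelevant by the
    hypothesis [free], the second because [item_cond_prob] overwrites it. *)
Lemma item_prob_extend_off b z : item_prob b (extend_off (restr z)) = item_prob b z.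
Proof.
case: z => x m.
rewrite /extend_off/= -(item_prob_set_item b _ _ (m j)).
rewrite (_ : set_item _ j (m j) = m).
  by apply: item_prob_off => k kj; rewrite mergeT.
apply/ffunP => k; have [->|kj] := eqVneq k j; first by rewrite set_item_at.
by rewrite set_item_neq// ffunE insubT ffunE.
Qed.

Lemma measurable_restr : measurable_fun setT restr.
Proof.
apply: measurable_pattern_prod => m; apply: measurable_fun_pair => /=;
  last exact: measurable_cst.
exact: measurable_subvector.
Qed.

Lemma cond_indep_item : cond_indep P A B C.
Proof.
have mA : measurable_fun setT A.
  exact: (measurableT_comp (@measurable_coord _ _ X j)
           (measurableT_comp measurable_fst mV)).
have mB : measurable_fun setT B.
  apply: (measurableT_comp (f := fun m : pattern 'I_p => m j)) => //.
  exact: (measurableT_comp measurable_snd mV).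
have mC : measurable_fun setT C by exact: (measurableT_comp measurable_restr mV).
split=> // a b ma mb.
have pre d1 (U : measurableType d1) (f : W -> U) (u : set U) :
    measurable_fun setT f -> measurable u -> measurable (f @^-1` u).
  by move=> mf mu'; rewrite -[X in measurable X]setTI; exact: mf.
have mAa := pre _ _ _ _ mA ma.
have [ha [ha0 [mha iha ha_int] ha_q]] := exists_cond_prob_version P mAa mC.
(* The conditional law given all the data, read as a function of the conditioning variable [C]
   alone. *)
pose hb := item_prob b \o extend_off.
have mhb : measurable_fun setT hb.
  exact: (measurableT_comp (measurable_item_prob b) measurable_extend_off).
have hb01 t : 0 <= hb t <= 1 by exact: item_prob01.
have hb0 t : 0 <= hb t by case/andP: (hb01 t).
have hb1 t : hb t <= 1 by case/andP: (hb01 t).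
have hbC w : hb (C w) = item_prob b (V w) by exact: item_prob_extend_off.
have restr_flip c x m e : restr (x, m) = c -> restr (x, set_item m j e) = c.
  move=> <-; rewrite /restr/=; congr pair; apply/ffunP => -[k kj].
  by rewrite !ffunE/= (negbTE kj).
have mrestr c : measurable c -> measurable (restr @^-1` c).
  by move=> mc; rewrite -[X in measurable X]setTI; exact: measurable_restr.
exists ha, hb; split => //; split => //.
(* Values in the unit interval are integrable under a probability. *)
- apply: (@le_integrable _ _ _ P setT measurableT _ (EFin \o cst 1)).
  + by apply/measurable_EFinP; exact: (measurableT_comp mhb).
  + by move=> w _; rewrite /= lee_fin !ger0_norm.
  + exact: finite_measure_integrable_cst.
- move=> c mc; under eq_integral do rewrite hbC.
  rewrite (integral_item_prob b (mrestr _ mc)); last first.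
    by move=> x m e; rewrite /preimage/= (restr_flip _ _ _ _ erefl).
  by rewrite preimage_setI setIC.
- exact: measurable_funM.
- apply: le_integrable iha => //.
  + apply/measurable_EFinP; apply: measurable_funM; first exact: (measurableT_comp mha).
    exact: (measurableT_comp mhb).
  + by move=> w _; rewrite /= lee_fin !ger0_norm ?mulr_ge0// ler_piMr.
(* The weight [hb] turns the integral of the product into an integral of [hb] over the event on [A]
   and [C]. That event does not involve the [j]th indicator, so [integral_item_prob] evaluates
   it. *)
- move=> c mc; rewrite ha_q//; under eq_integral do rewrite hbC.
  rewrite (_ : _ `&` _ = V @^-1` ((fun z => z.1 j) @^-1` a `&` restr @^-1` c))//.
  rewrite (integral_item_prob b).
  + by rewrite !preimage_setI setIAC.
  + apply: measurableI; last exact: mrestr.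
    rewrite -[X in measurable X]setTI.
    by apply: (measurableT_comp (@measurable_coord _ _ X j) measurable_fst).
  + by move=> x m e []; split=> //; rewrite /preimage/= (restr_flip _ _ _ _ erefl).
Qed.

End CondIndep.

Theorem theorem2 (R : realType) (p : nat) (hp : (0 < p)%N)
  (d : 'I_p -> measure_display) (X : forall j, measurableType (d j))
  (mu : forall j, {sigma_finite_measure set (X j) -> \bar R})
  (M : {set pattern 'I_p}) (hM : pattern0 'I_p \in M)
  (f : prodspace X * pattern 'I_p -> R)
  (hf : is_prob_density (full_measure mu M) (full_space X M) f)
  (hobs : forall m, m \in M -> forall z : obs_space X m,
     (0 < obs_density mu f z < +oo)%E)
  (eta : eta_family R X)
  (hnorm : forall m, m \in M -> forall z : obs_space X m,
     (0 < eta_norm mu M eta z < +oo)%E)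
  (heta : eta_recursion mu M f eta) :
  let g := model_density M eta in
  [/\ is_prob_density (full_measure mu M) (full_space X M) g,
      forall j, item_cond_prob_free M g j &
      forall (d' : measure_display) (W : measurableType d')
        (P : probability W R)
        (V : {RV P >-> (prodspace X * pattern 'I_p)%type}),
        has_density (full_measure mu M) (full_space X M) P V g ->
        itemwise_cond_indep P V].
Proof.
move=> g; split.
- exact: (@is_prob_density_model_density _ _ _ _ _ _ f).
- by move=> j m _ x x'; exact: item_cond_prob_model_density.
move=> d' W P V hV j; apply: (@cond_indep_item _ _ _ _ mu M g).
- exact: (@measurable_model_density _ _ _ _ mu _ f).
- exact: model_density_ge0.
- by move=> x m mM; rewrite /g /model_density/= (negbTE mM).
- by move=> m x x'; exact: item_cond_prob_model_density.
(* Since [g] vanishes off [full_space], integrating over [A] or over its part inside [full_space]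
   gives the same value. *)
move=> A mA; rewrite hV// integral_mkcondr; apply: eq_integral => -[x m] _.
rewrite patchE; case: ifPn => //; rewrite notin_setE /full_space/= => /negP mM.
by rewrite /g /model_density/= (negbTE mM).
Qed.
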